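(* Let $K\subset\mathbb{R}^2$ be a compact convex set with boundary of class $C^2$ and of constant width. If $K$ has an isotopic circle, i.e. if for some $\alpha\in(0,\pi)$ the isotopic set $C_\alpha$ of $K$ is a circle, then $K$ is a disc.
   Context: The visual angle $w(P)$ of $K$ from a point $P\notin K$ is the angle in $(0,\pi)$ under which $K$ is seen from $P$, i.e. the angle at $P$ of the smallest angular sector with vertex $P$ containing $K$ (the angle between the two support lines of $K$ through $P$). The isotopic set is $C_\alpha=\{P\in\mathbb{R}^2\setminus K: w(P)=\alpha\}$; when $C_\alpha$ is a circle it is called an isotopic circle of $K$. The support function of $K$ is $p(\varphi)=\max_{(x,y)\in K}(x\cos\varphi+y\sin\varphi)$; $K$ has constant width if $p(\varphi)+p(\varphi+\pi)$ does not depend on $\varphi$. *)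

(* Defs.v *)
From HB Require Import structures.
From mathcomp Require Import all_boot all_order all_algebra.
From mathcomp Require Import all_classical all_reals all_analysis.

Set Implicit Arguments.
Unset Strict Implicit.
Unset Printing Implicit Defensive.

Import Order.TTheory GRing.Theory Num.Theory.
Import numFieldNormedType.Exports.

Local Open Scope classical_set_scope.
Local Open Scope ring_scope.

Section PlaneGeometry.
Variable R : realType.

(* The plane is 'rV[R]_2. The library norm `|P| on it is the max norm (it
   induces the usual topology), hence the separate Euclidean norm below. *)

Definition dot (P Q : 'rV[R]_2) : R := \sum_(i < 2) P 0 i * Q 0 i.

Definition enorm (P : 'rV[R]_2) : R := Num.sqrt (dot P P).

Definition circle (c : 'rV[R]_2) (r : R) : set 'rV[R]_2 :=
  [set P | enorm (P - c) = r].

Definition disc (c : 'rV[R]_2) (r : R) : set 'rV[R]_2 :=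
  [set P | enorm (P - c) <= r].

Definition is_circle (A : set 'rV[R]_2) : Prop :=
  exists c r, 0 < r /\ A = circle c r.

Definition is_disc (A : set 'rV[R]_2) : Prop :=
  exists c r, 0 < r /\ A = disc c r.

Definition direction (phi : R) : 'rV[R]_2 :=
  \row_(i < 2) (if i == 0 then cos phi else sin phi).

Definition boundary (K : set 'rV[R]_2) : set 'rV[R]_2 := closure K `\` K°.

Definition C2_curve (g : R -> 'rV[R]_2) : Prop :=
  [/\ forall t, derivable g t 1,
      forall t, derivable (derive1 g) t 1 &
      continuous (derive1n 2 g)].

(* The boundary is the trace of a simple closed regular C^2 curve, given by
   a periodic parametrization that is injective on one period. *)
Definition C2_boundary (K : set 'rV[R]_2) : Prop :=
  exists (g : R -> 'rV[R]_2) (T : R),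
    [/\ 0 < T, C2_curve g & forall t, derive1 g t != 0] /\
    [/\ forall t, g (t + T) = g t,
        {in `[0, T[ &, injective g} &
        boundary K = range g].

(* For nonempty compact K the supremum is attained. *)
Definition support_function (K : set 'rV[R]_2) (phi : R) : R :=
  sup [set dot P (direction phi) | P in K].

Definition constant_width (K : set 'rV[R]_2) : Prop :=
  exists d, forall phi,
    support_function K phi + support_function K (phi + pi) = d.

(* Closed sector with vertex P and opening beta, swept counterclockwise from
   the ray of direction theta. *)
Definition sector (P : 'rV[R]_2) (theta beta : R) : set 'rV[R]_2 :=
  [set Q | exists r psi, [/\ 0 <= r, theta <= psi <= theta + beta &
                             Q = P + r *: direction psi]].

(* Opening of the smallest sector with vertex P containing K; for compact K
   the infimum is attained. *)
Definition visual_angle (K : set 'rV[R]_2) (P : 'rV[R]_2) : R :=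
  inf [set beta | 0 <= beta /\ exists theta, K `<=` sector P theta beta].

Definition isotopic_set (K : set 'rV[R]_2) (alpha : R) : set 'rV[R]_2 :=
  [set P | ~ K P /\ visual_angle K P = alpha].

End PlaneGeometry.

(* Main.v *)
(* Measure the support function h from the centre of the isotopic circle, of
   radius r, and put beta = pi - alpha. The support lines with normals phi and
   phi + beta meet on the circle, so that
     h1^2 + h2^2 - 2 h1 h2 cos beta = r^2 sin^2 beta
   with h1 = h phi and h2 = h (phi + beta). Constant width d gives
   h (phi + pi) = d - h phi, so the same relation holds for d - h1 and d - h2;
   subtracting yields h1 + h2 = d, and then h1 h2 is constant. By continuity h
   takes the value d / 2 between phi and phi + beta, so h1 h2 = d^2 / 4 and
   h = d / 2 everywhere. *)
Require Import Defs.
From mathcomp Require Import all_boot all_order all_algebra.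
From mathcomp Require Import all_classical all_reals all_analysis.
From mathcomp Require Import ring lra.

Import Order.TTheory GRing.Theory Num.Theory.
Import numFieldNormedType.Exports.

Local Open Scope classical_set_scope.
Local Open Scope ring_scope.

(** * Scalar products, rotating frames and polar coordinates *)

Lemma dotE {R : realType} (P Q : 'rV[R]_2) :
  dot P Q = P 0 0 * Q 0 0 + P 0 1 * Q 0 1.
Proof.
rewrite /dot big_ord_recl big_ord1.
by rewrite (_ : lift ord0 ord0 = 1) //; apply/val_inj.
Qed.

Lemma dot_directionE {R : realType} (P : 'rV[R]_2) (phi : R) :
  dot P (direction phi) = P 0 0 * cos phi + P 0 1 * sin phi.
Proof. by rewrite dotE !mxE. Qed.

Lemma dotC {R : realType} (P Q : 'rV[R]_2) : dot P Q = dot Q P.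
Proof. by rewrite !dotE; ring. Qed.

Lemma dotDl {R : realType} (P Q V : 'rV[R]_2) :
  dot (P + Q) V = dot P V + dot Q V.
Proof. by rewrite !dotE !mxE; ring. Qed.

Lemma dotBl {R : realType} (P Q V : 'rV[R]_2) :
  dot (P - Q) V = dot P V - dot Q V.
Proof. by rewrite !dotE !mxE; ring. Qed.

Lemma dotZl {R : realType} (r : R) (P V : 'rV[R]_2) :
  dot (r *: P) V = r * dot P V.
Proof. by rewrite !dotE !mxE; ring. Qed.

Lemma dot_directions {R : realType} (a b : R) :
  dot (direction a) (direction b) = cos (a - b).
Proof. by rewrite dot_directionE !mxE cosB. Qed.

Lemma directionDpi {R : realType} (a : R) :
  direction (a + pi) = - direction a.
Proof. by apply/rowP => i; rewrite !mxE cosDpi sinDpi; case: ifP. Qed.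

Lemma row2P {R : realType} (P Q : 'rV[R]_2) :
  P 0 0 = Q 0 0 -> P 0 1 = Q 0 1 -> P = Q.
Proof.
move=> e0 e1; apply/rowP => -[[|[|//]] i].
  by rewrite (_ : Ordinal i = 0) //; apply/val_inj.
by rewrite (_ : Ordinal i = 1) //; apply/val_inj.
Qed.

Lemma row_frameE {R : realType} (V : 'rV[R]_2) (a : R) :
  V = dot V (direction a) *: direction a +
      dot V (direction (a + pi / 2)) *: direction (a + pi / 2).
Proof.
have cs := cos2Dsin2 a.
apply: row2P; rewrite !dot_directionE !mxE /= cosDpihalf sinDpihalf.
  (* Multiplying by [cos a ^+ 2 + sin a ^+ 2] turns the goal into a polynomial identity. *)
  by rewrite -[LHS]mulr1 -cs; ring.
by rewrite -[LHS]mulr1 -cs; ring.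
Qed.

Lemma dot_frameE {R : realType} (V : 'rV[R]_2) (a : R) :
  dot V V =
  dot V (direction a) ^+ 2 + dot V (direction (a + pi / 2)) ^+ 2.
Proof.
rewrite dotE !dot_directionE cosDpihalf sinDpihalf.
by rewrite -[LHS]mulr1 -(cos2Dsin2 a); ring.
Qed.

(** On the half-plane to the left of [direction a], the arccosine of the normalized first frame
    coordinate is the polar angle. The range of [psi] is what sector membership later needs. *)
Lemma row_polar {R : realType} (V : 'rV[R]_2) (a : R) :
  0 <= dot V (direction (a + pi / 2)) ->
  exists r psi, [/\ 0 <= r, 0 <= psi <= pi & V = r *: direction (a + psi)].
Proof.
set x := dot V (direction a); set y := dot V _ => y0.
have VE : V = x *: direction a + y *: direction (a + pi / 2).
  exact: row_frameE.
have [V0|Vn0] := eqVneq (x ^+ 2 + y ^+ 2) 0.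
  exists 0, 0; split => //; first by rewrite lexx pi_ge0.
  have x0 : x = 0 by nra.
  have {}y0 : y = 0 by nra.
  by rewrite VE x0 y0 !scale0r addr0.
have q0 : 0 < x ^+ 2 + y ^+ 2.
  by rewrite lt_neqAle eq_sym Vn0 addr_ge0 // sqr_ge0.
pose r := Num.sqrt (x ^+ 2 + y ^+ 2).
have r0 : 0 < r by rewrite sqrtr_gt0.
have r2 : r ^+ 2 = x ^+ 2 + y ^+ 2 by rewrite sqr_sqrtr // ltW.
have xr : -1 <= x / r <= 1.
  by rewrite ler_pdivrMr // ler_pdivlMr // mulN1r mul1r; apply/andP; split; nra.
(* The sign of [y] selects the root, so that the arccosine also yields the correct sine. *)
have yr : Num.sqrt (1 - (x / r) ^+ 2) = y / r.
  have -> : y / r = Num.sqrt ((y / r) ^+ 2).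
    by rewrite sqrtr_sqr ger0_norm// divr_ge0// ltW.
  congr Num.sqrt.
  have rn0 : r ^+ 2 != 0 by rewrite r2.
  by rewrite !expr_div_n -(divff rn0) {1}r2; field; rewrite gt_eqF.
exists r, (acos (x / r)); split; first exact: ltW.
  by rewrite acos_ge0 // acos_lepi.
have cE : r * cos (acos (x / r)) = x.
  by rewrite acosK ?in_itv// mulrC divfK// gt_eqF.
have sE : r * sin (acos (x / r)) = y.
  by rewrite sin_acos// yr mulrC divfK// gt_eqF.
move: cE sE; move: (acos _) => p cE sE.
rewrite VE -cE -sE; apply: row2P; rewrite !mxE /=.
  by rewrite cosDpihalf cosD; ring.
by rewrite sinDpihalf sinD; ring.
Qed.

(** * Attainment and continuity of the support function *)

Lemma continuous_dot {R : realType} (V : 'rV[R]_2) :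
  continuous (fun P => dot P V).
Proof.
have -> : (fun P => dot P V) =
    (fun P : 'rV[R]_2 => P 0 0 * V 0 0 + P 0 1 * V 0 1).
  by apply/funext => P; rewrite dotE.
move=> P.
have c0 : {for P, continuous (fun Q : 'rV[R]_2 => Q 0 0)}.
  exact: coord_continuous.
have c1 : {for P, continuous (fun Q : 'rV[R]_2 => Q 0 1)}.
  exact: coord_continuous.
exact: (continuousD (continuousM c0 (@cst_continuous _ _ (V 0 0) P))
                    (continuousM c1 (@cst_continuous _ _ (V 0 1) P))).
Qed.

Lemma support_function_attained {R : realType} (K : set 'rV[R]_2) (phi : R) :
  compact K -> K !=set0 ->
  exists2 A, K A & dot A (direction phi) = support_function K phi.
Proof.
move=> cK K0.
have cf : {within K, continuous (fun P => dot P (direction phi))}.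
  by apply: continuous_subspaceT; exact: continuous_dot.
have [A /set_mem KA Amax] := compact_EVT_max K0 cK cf.
exists A => //; apply/eqP; rewrite eq_le; apply/andP; split.
  apply: ub_le_sup; last by exists A.
  by exists (dot A (direction phi)) => _ [Q KQ <-]; apply: Amax; exact/mem_set.
apply: ge_sup; first by exists (dot A (direction phi)); exists A.
by move=> _ [Q KQ <-]; apply: Amax; exact/mem_set.
Qed.

Lemma support_function_ub {R : realType} (K : set 'rV[R]_2) (phi : R) Q :
  compact K -> K Q -> dot Q (direction phi) <= support_function K phi.
Proof.
move=> cK KQ; apply: ub_le_sup; last by exists Q.
have K0 : K !=set0 by exists Q.
have cf : {within K, continuous (fun P => dot P (direction phi))}.
  by apply: continuous_subspaceT; exact: continuous_dot.
have [A KA Amax] := compact_EVT_max K0 cK cf.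
by exists (dot A (direction phi)) => _ [X KX <-]; apply: Amax; exact/mem_set.
Qed.

(** A coordinate bound [M] for [K] controls the variation of the support function by that of [cos]
    and [sin]. *)
Lemma continuous_support_function {R : realType} (K : set 'rV[R]_2) :
  compact K -> K !=set0 -> continuous (support_function K).
Proof.
move=> cK K0.
have [M HM] : exists M, forall A, K A -> `|A 0 0| <= M /\ `|A 0 1| <= M.
  have /ex_strict_bound_gt0[M M0 HM] := compact_bounded cK.
  exists M => A KA; have /ltW AM := HM _ KA.
  split; apply: le_trans AM; rewrite [leRHS]/Num.Def.normr/= mx_normrE.
    by apply: (le_trans _ (le_bigmax _ _ (0, 0))) => /=.
  by apply: (le_trans _ (le_bigmax _ _ (0, 1))) => /=.
have M0 : 0 <= M by case: K0 => A /HM[+ _]; exact: le_trans.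
have lip x y : support_function K x - support_function K y <=
    M * (`|cos x - cos y| + `|sin x - sin y|).
  (* A contact point for [x] is a competitor for [y], which gives a one-sided estimate; exchanging
     [x] and [y] gives the other side. *)
  have [A KA <-] := support_function_attained K x cK K0.
  have AM := HM A KA.
  apply: (@le_trans _ _ (dot A (direction x) - dot A (direction y))).
    by rewrite lerD2l lerN2; exact: support_function_ub.
  rewrite !dot_directionE.
  have -> : A 0 0 * cos x + A 0 1 * sin x - (A 0 0 * cos y + A 0 1 * sin y) =
     A 0 0 * (cos x - cos y) + A 0 1 * (sin x - sin y) by ring.
  rewrite [leRHS]mulrDr; apply: lerD; rewrite (le_trans (ler_norm _))// normrM.
    by rewrite ler_wpM2r// AM.1.
  by rewrite ler_wpM2r// AM.2.
move=> x; apply/cvgrPdist_le => e e0.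
have ccos : `|cos x - cos y| @[y --> x] --> 0.
  rewrite -(normr0 R) -(subrr (cos x)).
  apply: cvg_norm; apply: cvgB; first exact: cvg_cst.
  exact: continuous_cos.
have csin : `|sin x - sin y| @[y --> x] --> 0.
  rewrite -(normr0 R) -(subrr (sin x)).
  apply: cvg_norm; apply: cvgB; first exact: cvg_cst.
  exact: continuous_sin.
have c0 : M * (`|cos x - cos y| + `|sin x - sin y|) @[y --> x] --> 0.
  rewrite -(mulr0 M) -[X in M * X](addr0 0).
  by apply: cvgM; [exact: cvg_cst|exact: cvgD].
move/cvgrPdist_le : c0 => /(_ e e0); apply: filterS => y.
rewrite sub0r normrN => he; apply: le_trans he.
rewrite [leRHS]ger0_norm ?mulr_ge0 ?addr_ge0 ?normr_ge0//.
have := lip x y; have := lip y x.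
rewrite (distrC (cos y)) (distrC (sin y)) ler_norml => h1 h2.
by rewrite h2 andbT lerNl opprB.
Qed.

(** * Support lines at boundary points *)

Lemma boundary_compact_subset {R : realType} (K : set 'rV[R]_2) :
  compact K -> boundary K `<=` K.
Proof.
move=> cK P [+ _]; have /closure_id <- // : closed K.
by apply: (compact_closed _ cK); exact: norm_hausdorff.
Qed.

(** A small move from an interior point along [direction a] would stay in [K] and exceed the support
    value. *)
Lemma interior_not_support {R : realType} (K : set 'rV[R]_2) (a : R) P :
  compact K -> dot P (direction a) = support_function K a -> ~ (K° P).
Proof.
move=> cK Pa KP.
have cl : (P + t *: direction a) @[t --> (0 : R)] --> P.
  rewrite -[X in _ --> X]addr0 -(scale0r (direction a)).
  apply: cvgD; first exact: cvg_cst.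
  by apply: cvgZr_tmp; exact: cvg_id.
have : \forall t \near (0 : R)^'+, K (P + t *: direction a).
  by apply: (cvg_within _); exact: (cl _ KP).
move=> nK; near (0 : R)^'+ => t.
have KPt : K (P + t *: direction a) by near: t.
have t0 : 0 < t by near: t; exact: nbhs_right_gt.
have := support_function_ub K a _ cK KPt.
by rewrite dotDl dotZl dot_directions subrr cos0 mulr1 Pa gerDl leNgt t0.
Unshelve. all: by end_near. Qed.

Lemma derive1_dot {R : realType} (g : R -> 'rV[R]_2) (t : R) (V : 'rV[R]_2) :
  derivable g t 1 -> is_derive t 1 (fun t => dot (g t) V) (dot (derive1 g t) V).
Proof.
move=> dg; have dx i j := (derivable_mxP g t 1).1 dg i j.
have -> : (fun t => dot (g t) V) =
    V 0 0 *: (fun t => g t 0 0) + V 0 1 *: (fun t => g t 0 1).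
  apply/funext => s; rewrite dotE !fctE /=.
  by rewrite mulrC [X in _ + X]mulrC.
have -> : dot (derive1 g t) V =
    V 0 0 *: 'D_1 (fun t => g t 0 0) t + V 0 1 *: 'D_1 (fun t => g t 0 1) t.
  by rewrite dotE derive1E derive_mx// !mxE mulrC [X in _ + X]mulrC.
have d0 := derivableP (dx 0 0).
have d1 := derivableP (dx 0 1).
exact: is_deriveD.
Qed.

(* At a regular boundary point all supporting normals are orthogonal to the
   same nonzero tangent vector, hence parallel. *)
Lemma support_normal_unique {R : realType} (K : set 'rV[R]_2) (a b : R) P :
  compact K -> C2_boundary K -> K P ->
  dot P (direction a) = support_function K a ->
  dot P (direction b) = support_function K b -> sin (b - a) = 0.
Proof.
move=> cK [g [T [[T0 [dg _ _] g'0] [_ _ bK]]]] KP Pa Pb.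
have : boundary K P.
  split; first exact: subset_closure.
  exact: interior_not_support Pa.
rewrite bK => -[t0 _ gt0].
have gK t : K (g t).
  by apply: boundary_compact_subset => //; rewrite bK; exists t.
(* The parameter [t0] maximizes the component of [g] along [direction c], so the derivative of that
   component vanishes. *)
have crit c : dot P (direction c) = support_function K c ->
    dot (derive1 g t0) (direction c) = 0.
  move=> Pc.
  have d1 := derive1_dot g t0 (direction c) (dg t0).
  have d2 : is_derive t0 1 (fun t => dot (g t) (direction c)) 0.
    apply: (@derive1_at_max _ _ (t0 - 1) (t0 + 1)).
    - by rewrite lerD2l; lra.
    - by move=> t _; have [] := derive1_dot g t (direction c) (dg t).
    - by rewrite in_itv /=; apply/andP; split; lra.
    - by move=> t _; rewrite gt0 Pc; exact: support_function_ub.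
  by rewrite -(@derive_val _ _ _ _ _ _ _ d1) (@derive_val _ _ _ _ _ _ _ d2).
have := crit a Pa; have := crit b Pb; have := g'0 t0.
move: (derive1 g t0) => V V0; rewrite !dot_directionE => hb ha.
apply/eqP; apply: contraNT V0 => sab.
(* Cramer's rule: the two orthogonality relations form a linear system in [V] with determinant
   [sin (b - a)]. *)
have V00 : V 0 0 * sin (b - a) = 0.
  rewrite sinB; transitivity ((V 0 0 * cos a + V 0 1 * sin a) * sin b -
    (V 0 0 * cos b + V 0 1 * sin b) * sin a); first by ring.
  by rewrite ha hb !mul0r subrr.
have V01 : V 0 1 * sin (b - a) = 0.
  rewrite sinB; transitivity ((V 0 0 * cos b + V 0 1 * sin b) * cos a -
    (V 0 0 * cos a + V 0 1 * sin a) * cos b); first by ring.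
  by rewrite ha hb !mul0r subrr.
move/eqP: V00; rewrite mulf_eq0 (negbTE sab) orbF => /eqP V00.
move/eqP: V01; rewrite mulf_eq0 (negbTE sab) orbF => /eqP V01.
by apply/eqP/row2P; rewrite !mxE.
Qed.

(** * Visual angle from the intersection of two support lines *)

(** The two supporting half-planes through [P] intersect in this sector: the one with normal
    [phi + beta] puts the angle [psi] in [[0, pi]], and the one with normal [phi] cuts it down to
    [pi - beta]. *)
Lemma support_sector {R : realType} (K : set 'rV[R]_2) (phi beta : R) P :
  compact K -> 0 < beta < pi ->
  dot P (direction phi) = support_function K phi ->
  dot P (direction (phi + beta)) = support_function K (phi + beta) ->
  K `<=` sector P (phi + beta + pi / 2) (pi - beta).
Proof.
move=> cK /andP[b0 bpi] P1 P2 Q KQ.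
pose th := phi + beta + pi / 2.
have thE : th + pi / 2 = phi + beta + pi by rewrite /th; field.
have [|r [psi [r0 /andP[psi0 psipi] QE]]] := row_polar (Q - P) th.
  rewrite thE directionDpi -scaleN1r.
  have := support_function_ub K (phi + beta) Q cK KQ.
  by rewrite -P2 !dotE !mxE; lra.
(* At the vertex the polar angle is arbitrary, so the first edge [th] serves. *)
have [r00|rn0] := eqVneq r 0.
  exists 0, th; split => //; first by rewrite lexx lerDl; lra.
  by rewrite scale0r addr0 -(subrK P Q) QE r00 scale0r add0r.
exists r, (th + psi); split => //; last by rewrite -QE addrC subrK.
rewrite lerDl psi0 lerD2l /=.
have := support_function_ub K phi Q cK KQ.
rewrite -P1 -subr_le0 -dotBl QE dotZl dot_directions.
have -> : th + psi - phi = (psi + beta) + pi / 2 by rewrite /th; ring.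
rewrite cosDpihalf mulrN oppr_le0 pmulr_rge0; last by rewrite lt_def rn0.
(* If [psi] exceeded [pi - beta], then [psi + beta - pi] would lie strictly between [0] and [pi],
   making [sin (psi + beta)] negative. *)
rewrite leNgt => s0; rewrite leNgt; apply: contra s0 => h.
have -> : psi + beta = psi + beta - pi + pi by ring.
by rewrite sinDpi oppr_lt0; apply: sin_gt0_pi; apply/andP; split; lra.
Qed.

(** The supporting half-planes give the upper bound. For the lower bound, [K] touches each line at a
    point other than [P]; seen from [P], these contact points lie along the two edges, so no
    narrower sector contains both. *)
Lemma visual_angle_support {R : realType} (K : set 'rV[R]_2)
    (phi beta : R) P :
  compact K -> K !=set0 -> 0 < beta < pi -> ~ K P ->
  dot P (direction phi) = support_function K phi ->
  dot P (direction (phi + beta)) = support_function K (phi + beta) ->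
  visual_angle K P = pi - beta.
Proof.
move=> cK K0 bb nKP P1 P2; have /andP[b0 bpi] := bb.
set S := [set b | 0 <= b /\ exists theta, K `<=` sector P theta b].
have aS : S (pi - beta).
  split; first lra.
  by exists (phi + beta + pi / 2); exact: support_sector.
apply/eqP; rewrite eq_le; apply/andP; split.
  by apply: ge_inf => //; exists 0 => b [].
apply: lb_le_inf; first by exists (pi - beta).
move=> b [bge0 [th Kth]]; rewrite leNgt; apply/negP => blt.
have [A KA A2] := support_function_attained K (phi + beta) cK K0.
have [B KB B1] := support_function_attained K phi cK K0.
have sb : 0 < sin beta by exact: sin_gt0_pi.
(* Uniqueness of polar coordinates away from [P]: the sector angle of a point of [K] on the ray
   along [e] has the same direction as [e]. *)
have ray Q e : K Q -> sector P th b Q -> 0 <= dot (Q - P) (direction e) ->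
    Q - P = dot (Q - P) (direction e) *: direction e ->
    exists2 psi, th <= psi <= th + b & direction psi = direction e.
  move=> KQ [r [psi [r0 psiI QE]]] s0 se.
  have {}QE : Q - P = r *: direction psi by rewrite QE addrC addKr.
  have sn0 : dot (Q - P) (direction e) != 0.
    apply: contra_notN nKP => /eqP s00.
    by move: se; rewrite s00 scale0r => /eqP; rewrite subr_eq0 => /eqP <-.
  exists psi => //.
  have rs : r = dot (Q - P) (direction e).
    apply/eqP; rewrite -(@eqrXn2 _ 2)//; apply/eqP.
    transitivity (dot (Q - P) (Q - P)).
      by rewrite QE dotZl dotC dotZl dot_directions subrr cos0; ring.
    rewrite [RHS]expr2; move: se; set s := dot _ _ => se.
    by rewrite se dotZl dotC dotZl dot_directions subrr cos0; ring.
  by apply/(scalerI sn0); rewrite -{1}rs -QE.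
have Aperp : dot (A - P) (direction (phi + beta)) = 0.
  by rewrite dotBl A2 P2 subrr.
have Bperp : dot (B - P) (direction phi) = 0.
  by rewrite dotBl B1 P1 subrr.
have AE := row_frameE (A - P) (phi + beta).
have BE := row_frameE (B - P) phi.
rewrite Aperp scale0r add0r in AE; rewrite Bperp scale0r add0r in BE.
(* As [sin beta] is positive, the other support inequality decides on which side of [P] each contact
   point lies. *)
have A0 : 0 <= dot (A - P) (direction (phi + beta + pi / 2)).
  have := support_function_ub K phi A cK KA.
  rewrite -P1 -subr_le0 -dotBl {1}AE dotZl dot_directions.
  have -> : phi + beta + pi / 2 - phi = beta + pi / 2 by ring.
  by rewrite cosDpihalf mulrN oppr_le0 pmulr_lge0.
have B0 : dot (B - P) (direction (phi + pi / 2)) <= 0.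
  have := support_function_ub K (phi + beta) B cK KB.
  rewrite -P2 -subr_le0 -dotBl {1}BE dotZl dot_directions.
  have -> : phi + pi / 2 - (phi + beta) = - beta + pi / 2 by ring.
  by rewrite cosDpihalf sinN opprK pmulr_lle0.
have [psiA psiAI uA] := ray A _ KA (Kth _ KA) A0 AE.
have Bopp : dot (B - P) (direction (phi + pi / 2 + pi)) =
            - dot (B - P) (direction (phi + pi / 2)).
  by rewrite directionDpi !dotE !mxE; ring.
have [|| psiB psiBI uB] := ray B (phi + pi / 2 + pi) KB (Kth _ KB).
- by rewrite Bopp oppr_ge0.
- by rewrite Bopp directionDpi scaleNr scalerN opprK.
(* Both [pi - beta] and the angular gap, which is at most [b], lie in [[0, pi]], where [cos] is
   injective; the gap is then [pi - beta], contradicting [b < pi - beta]. *)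
have cE : cos `|psiA - psiB| = cos (pi - beta).
  rewrite cos_norm -dot_directions uA uB dot_directions.
  by rewrite -cosN; congr cos; field.
have hb : `|psiA - psiB| <= b.
  rewrite ler_norml; apply/andP; split; lra.
have hpi : `|psiA - psiB| = pi - beta.
  apply: cos_inj => //; rewrite in_itv /= ?normr_ge0 /=; first lra.
  by apply/andP; split; lra.
by move: hb; rewrite hpi leNgt blt.
Qed.

(** * Discs recognized by their support function *)

Lemma convex_segment {R : realType} (K : set 'rV[R]_2) (A B : 'rV[R]_2)
    (t : R) :
  convex_set K -> K A -> K B -> 0 <= t -> t <= 1 ->
  K (t *: A + (1 - t) *: B).
Proof.
move=> cvxK KA KB t0 t1.
by have /set_mem := cvxK A B (Itv01 t0 t1) (mem_set KA) (mem_set KB).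
Qed.

Lemma row_polar_ex {R : realType} (V : 'rV[R]_2) :
  exists r psi, 0 <= r /\ V = r *: direction psi.
Proof.
have [V0|V0] := leP 0 (dot V (direction (0 + pi / 2))).
  by have [r [psi [r0 _ VE]]] := row_polar V 0 V0; exists r, (0 + psi).
have [|r [psi [r0 _ VE]]] := row_polar V pi; last by exists r, (pi + psi).
have -> : (pi + pi / 2 : R) = 0 + pi / 2 + pi by field.
by rewrite directionDpi; move: V0; rewrite !dotE !mxE; lra.
Qed.

Lemma enorm_polar {R : realType} (r psi : R) :
  0 <= r -> enorm (r *: direction psi) = r.
Proof.
move=> r0; rewrite /enorm dotZl dotC dotZl dot_directions subrr cos0 mulr1.
by rewrite -expr2 sqrtr_sqr ger0_norm.
Qed.

(** The support inequality in the direction of each point keeps [K] inside the disc. Contact points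
    fill the bounding circle, and convexity fills the inside along diameters. *)
Lemma disc_of_constant_support {R : realType} (K : set 'rV[R]_2) c (rho : R) :
  compact K -> convex_set K -> K !=set0 -> 0 < rho ->
  (forall phi, support_function K phi - dot c (direction phi) = rho) ->
  K = disc c rho.
Proof.
move=> cK cvxK K0 rho0 hK.
have Kdisc Q : K Q -> disc c rho Q.
  move=> KQ; have [r [psi [r0 QE]]] := row_polar_ex (Q - c).
  rewrite /disc /= QE enorm_polar//.
  have <- : dot (Q - c) (direction psi) = r.
    by rewrite QE dotZl dot_directions subrr cos0 mulr1.
  by rewrite dotBl -(hK psi) lerD2r; exact: support_function_ub.
have circK psi : K (c + rho *: direction psi).
  have [A KA Apsi] := support_function_attained K psi cK K0.
  have [r [psi' [r0 AE]]] := row_polar_ex (A - c).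
  have rrho : r <= rho.
    by have := Kdisc A KA; rewrite /disc /= AE enorm_polar.
  have Adot : dot (A - c) (direction psi) = rho by rewrite dotBl Apsi hK.
  have AA : dot (A - c) (A - c) = r ^+ 2.
    by rewrite AE dotZl dotC dotZl dot_directions subrr cos0; ring.
  have := dot_frameE (A - c) psi; rewrite Adot AA.
  set z := dot _ _ => rz.
  (* The component along [direction psi] already has length [rho], so a point of the disc has
     nothing left for the orthogonal one. *)
  have z0 : z = 0.
    apply/eqP; rewrite -sqrf_eq0 eq_le sqr_ge0 andbT.
    suff : r ^+ 2 <= rho ^+ 2 by lra.
    by rewrite lerXn2r// nnegrE ltW.
  suff <- : A - c = rho *: direction psi by rewrite addrC subrK.
  by rewrite [LHS](row_frameE (A - c) psi) Adot -/z z0 scale0r addr0.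
apply/seteqP; split => // Q; have [r [psi [r0 QE]]] := row_polar_ex (Q - c).
rewrite /disc /= QE enorm_polar// => rrho.
have K1 := circK psi; have K2 := circK (psi + pi).
(* The weight [t] solves [t * rho - (1 - t) * rho = r], placing [Q] on the diameter between the
   antipodal points. *)
have t0 : 0 <= (1 + r / rho) / 2.
  by rewrite divr_ge0// addr_ge0// divr_ge0// ltW.
have t1 : (1 + r / rho) / 2 <= 1.
  have : r / rho <= 1 by rewrite ler_pdivrMr// mul1r.
  by lra.
have := convex_segment K _ _ _ cvxK K1 K2 t0 t1.
suff -> : Q = (1 + r / rho) / 2 *: (c + rho *: direction psi) +
  (1 - (1 + r / rho) / 2) *: (c + rho *: direction (psi + pi)) by [].
rewrite -(subrK c Q) QE directionDpi.
apply: row2P; rewrite !mxE /=; field; exact: lt0r_neq0.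
Qed.

(** * Positivity of the width *)

Lemma width_ge0 {R : realType} (K : set 'rV[R]_2) (phi : R) :
  compact K -> K !=set0 ->
  0 <= support_function K phi + support_function K (phi + pi).
Proof.
move=> cK [Q KQ].
have := support_function_ub K phi Q cK KQ.
have := support_function_ub K (phi + pi) Q cK KQ.
by rewrite directionDpi !dotE !mxE; lra.
Qed.

(** With zero width every point of [K] attains the support value in every direction, hence has
    determined coordinates. This excludes [d = 0]. *)
Lemma width0_subsingleton {R : realType} (K : set 'rV[R]_2) P Q :
  compact K ->
  (forall phi, support_function K phi + support_function K (phi + pi) = 0) ->
  K P -> K Q -> P = Q.
Proof.
move=> cK w0 KP KQ.
have supp X phi : K X -> dot X (direction phi) = support_function K phi.
  move=> KX; have := support_function_ub K phi X cK KX.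
  have := support_function_ub K (phi + pi) X cK KX.
  have := w0 phi; rewrite directionDpi !dotE !mxE; lra.
apply/eqP; rewrite -subr_eq0; apply/eqP; rewrite (row_frameE (P - Q) 0).
by rewrite !dotBl !supp// !subrr !scale0r addr0.
Qed.

Lemma C2_boundary_two_points {R : realType} (K : set 'rV[R]_2) :
  compact K -> C2_boundary K -> exists P Q, [/\ K P, K Q & P <> Q].
Proof.
move=> cK [g [T [[T0 _ _] [_ ginj bK]]]].
have gK t : K (g t).
  by apply: boundary_compact_subset => //; rewrite bK; exists t.
exists (g 0), (g (T / 2)); split => // /ginj.
rewrite !in_itv /= lexx T0 /=.
have -> : 0 <= T / 2 < T by apply/andP; split; lra.
by move=> /(_ isT isT); lra.
Qed.

(* The support lines with normals [phi] and [phi + beta] meet in a point of the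
   isotopic set: it lies outside [K] because the boundary has no corner. *)
Lemma support_isotopic_circle {R : realType} (K : set 'rV[R]_2) (alpha : R)
    c (r phi : R) :
  let beta := pi - alpha in
  let h x := support_function K x - dot c (direction x) in
  compact K -> C2_boundary K -> K !=set0 -> 0 < alpha < pi ->
  isotopic_set K alpha `<=` circle c r ->
  h phi ^+ 2 + h (phi + beta) ^+ 2 - 2 * h phi * h (phi + beta) * cos beta =
  r ^+ 2 * sin beta ^+ 2.
Proof.
move=> beta h cK bK K0 /andP[a0 api] iso.
have b0 : 0 < beta < pi by rewrite /beta; apply/andP; split; lra.
have sb : sin beta != 0 by rewrite gt_eqF// sin_gt0_pi.
(* The coordinate along the first support line at which the second one crosses it, relative to [c];
   then [c + V] is the intersection point. *)
pose z := (h (phi + beta) - h phi * cos beta) / sin beta.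
pose V := h phi *: direction phi + z *: direction (phi + pi / 2).
have V1 : dot V (direction phi) = h phi.
  rewrite dotDl !dotZl !dot_directions subrr cos0.
  have -> : phi + pi / 2 - phi = pi / 2 by ring.
  by rewrite cos_pihalf; ring.
have V1' : dot V (direction (phi + pi / 2)) = z.
  rewrite dotDl !dotZl !dot_directions subrr cos0.
  have -> : phi - (phi + pi / 2) = - (pi / 2) by ring.
  by rewrite cosN cos_pihalf; ring.
have V2 : dot V (direction (phi + beta)) = h (phi + beta).
  rewrite dotDl !dotZl !dot_directions.
  have -> : phi - (phi + beta) = - beta by ring.
  have -> : phi + pi / 2 - (phi + beta) = - beta + pi / 2 by ring.
  by rewrite cosDpihalf cosN sinN /z; field.
have P1 : dot (c + V) (direction phi) = support_function K phi.
  by rewrite dotDl V1 /h addrC subrK.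
have P2 : dot (c + V) (direction (phi + beta)) =
    support_function K (phi + beta).
  by rewrite dotDl V2 /h addrC subrK.
have nK : ~ K (c + V).
  move=> KP; have := support_normal_unique K _ _ _ cK bK KP P1 P2.
  by rewrite addrC addKr => /eqP; rewrite (negbTE sb).
have /iso : isotopic_set K alpha (c + V).
  split => //; rewrite (visual_angle_support _ _ _ _ cK K0 b0 nK P1 P2).
  by rewrite /beta; ring.
rewrite /circle /= addrC addKr /enorm => Vr.
have <- : dot V V = r ^+ 2.
  by rewrite -Vr sqr_sqrtr// dotE addr_ge0// -expr2 sqr_ge0.
rewrite (dot_frameE V phi) V1 V1'.
transitivity (h phi ^+ 2 * sin beta ^+ 2 + (z * sin beta) ^+ 2); last by ring.
by rewrite divfK// sin2cos2; ring.
Qed.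

Theorem theorem5p1 (R : realType) (K : set 'rV[R]_2)
    (Kcompact : compact K) (Kconvex : convex_set K)
    (KC2 : C2_boundary K) (Kwidth : constant_width K)
    (Kisotopic : exists alpha : R,
        0 < alpha < pi /\ is_circle (isotopic_set K alpha)) :
  is_disc K.
Proof.
have [alpha [a0pi [c [r [_ isoE]]]]] := Kisotopic.
have [d width] := Kwidth.
have [P [Q [KP KQ PQ]]] := C2_boundary_two_points K Kcompact KC2.
have K0 : K !=set0 by exists P.
have d0 : 0 < d.
  rewrite lt_def -{2}(width 0) width_ge0// andbT.
  by apply: contra_notN PQ => /eqP d0; apply: width0_subsingleton KP KQ => //;
    move=> phi; rewrite width.
pose h x := support_function K x - dot c (direction x).
pose beta := pi - alpha.
have beta0pi : 0 < beta < pi.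
  by have /andP[? ?] := a0pi; rewrite /beta; apply/andP; split; lra.
have hpi x : h (x + pi) = d - h x.
  by rewrite /h -(width x) directionDpi !dotE !mxE; ring.
have F x : h x ^+ 2 + h (x + beta) ^+ 2 - 2 * h x * h (x + beta) * cos beta =
    r ^+ 2 * sin beta ^+ 2.
  apply: (support_isotopic_circle K alpha) => //.
  by rewrite isoE.
have sb : 0 < sin beta by exact: sin_gt0_pi.
(* The factors [1 - cos beta] and [1 + cos beta] are cancelled below. *)
have cb1 : cos beta != 1.
  apply: contraTneq sb => cb; have := sin2cos2 beta; rewrite cb expr1n subrr.
  by move/eqP; rewrite sqrf_eq0 => /eqP ->; rewrite ltxx.
have cbN1 : cos beta != -1.
  apply: contraTneq sb => cb; have := sin2cos2 beta.
  rewrite cb sqrrN expr1n subrr.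
  by move/eqP; rewrite sqrf_eq0 => /eqP ->; rewrite ltxx.
(* The relation [F] at [x] and at [x + pi], where [h] becomes [d - h],
   differ by a multiple of [d - (h x + h (x + beta))]. *)
have hsum x : h (x + beta) = d - h x.
  have := F (x + pi); rewrite [x + pi + beta]addrAC !hpi -(F x) => FF.
  have : 2 * d * (1 - cos beta) * (d - (h x + h (x + beta))) = 0.
    by move/eqP: FF; rewrite -subr_eq0 => /eqP <-; ring.
  move/eqP; rewrite !mulf_eq0 (gt_eqF d0) pnatr_eq0 /=.
  rewrite subr_eq0 eq_sym (negbTE cb1) /= subr_eq0 => /eqP ->.
  by ring.
(* Substituting [d - h x] for [h (x + beta)] in [F] and completing the square leaves a right-hand
   side independent of [x]. *)
have F' x : 2 * (1 + cos beta) * (h x - d / 2) ^+ 2 =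
    r ^+ 2 * sin beta ^+ 2 - d ^+ 2 * (1 - cos beta) / 2.
  by rewrite -(F x) hsum; field.
have hcont : continuous h.
  move=> x; apply: continuousB; first exact: continuous_support_function.
  have -> : (fun x => dot c (direction x)) =
      (fun x => c 0 0 * cos x + c 0 1 * sin x).
    by apply/funext => y; rewrite dot_directionE.
  apply: continuousD; (apply: continuousM; first exact: cst_continuous).
    exact: continuous_cos.
  exact: continuous_sin.
have [x0 _ hx0] : exists2 x0, x0 \in `[0, beta]%R & h x0 = d / 2.
  apply: IVT; first by case/andP: beta0pi => /ltW.
    exact: continuous_subspaceT.
  (* The values at [0] and [beta] add up to [d], so [d / 2] lies between them. *)
  have := hsum 0; rewrite add0r => ->.
  rewrite ge_min le_max; apply/andP.
  by case: (leP (h 0) (d / 2)) => hd; split; apply/orP;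
    [left|right|right|left]; lra.
(* The square in [F'] vanishes at [x0], so the constant is zero and the square vanishes
   everywhere. *)
have hconst x : h x = d / 2.
  have := F' x; rewrite -(F' x0) hx0 subrr expr0n /= mulr0 => /eqP.
  rewrite !mulf_eq0 pnatr_eq0 /= addrC addr_eq0 (negbTE cbN1) /= orbb.
  by rewrite subr_eq0 => /eqP.
exists c, (d / 2); split; first lra.
by apply: disc_of_constant_support => //; lra.
Qed.
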